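(* Let $D$ be a $\Lambda^+$-valued divisor on $\mathbb{P}^1$ satisfying the integrality assumption, and let $T_D(z)$ be the associated rational Lax matrix. Then the normalized matrix $\mathsf{T}_D(z):=Z_0(z)^{-1}T_D(z)$ has all its entries in $\mathcal{A}[z]$, i.e. $\mathsf{T}_D(z)\in\mathcal{A}[z]\otimes_{\mathbb{C}}\mathrm{End}\,\mathbb{C}^n$.
   Context: Let $n\ge2$, $\Lambda=\bigoplus_{j=1}^n\mathbb{Z}\epsilon_j$, $\epsilon^\vee_j$ dual basis, $\alpha^\vee_i=\epsilon^\vee_i-\epsilon^\vee_{i+1}$, $\alpha_i=\epsilon_i-\epsilon_{i+1}$, $\varpi_i=-\sum_{j=i+1}^n\epsilon_j$ ($0\le i\le n-1$), $\Lambda^+=\{\nu:\alpha^\vee_i(\nu)\ge0,\ 1\le i<n\}$. A $\Lambda^+$-valued divisor is $D=\sum_{s=1}^N\gamma_s\varpi_{i_s}[x_s]+\mu[\infty]$ with $0\le i_s\le n-1$, $x_s\in\mathbb{C}$, $\gamma_s=1$ if $i_s\ne0$, $\gamma_s\in\{\pm1\}$ if $i_s=0$, and $\mu\in\Lambda^+$. Integrality assumption: with $\lambda=\sum_s\gamma_s\varpi_{i_s}$, $\lambda+\mu=\sum_{i=1}^{n-1}a_i\alpha_i$ with $a_i\in\mathbb{Z}_{\ge0}$; $a_0=a_n=0$. $\mathcal{A}$: the $\mathbb{C}$-algebra generated by $p_{i,r},e^{\pm q_{i,r}},(p_{i,r}-p_{i,s}+m)^{-1}$ ($1\le i<n$,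 $1\le r\ne s\le a_i$, $m\in\mathbb{Z}$) with relations $[e^{\pm q_{i,r}},p_{j,s}]=\mp\delta_{ij}\delta_{rs}e^{\pm q_{i,r}}$, the $p$'s pairwise commute, the $e^{q}$'s pairwise commute, $e^{\pm q_{i,r}}e^{\mp q_{i,r}}=1$. $Z_i(z)=\prod_{s:i_s=i}(z-x_s)^{\gamma_s}$, $P_j(z)=\prod_{r=1}^{a_j}(z-p_{j,r})$, $P_{j,r}(z)=\prod_{s\ne r}(z-p_{j,s})$, $P_0=P_n=1$. Rational Lax matrix: define elements of $\mathcal{A}((z^{-1}))$ (rational expressions expanded in $z^{-1}$): $g^D_i(z)=\frac{P_i(z)}{P_{i-1}(z-1)}\prod_{k=0}^{i-1}Z_k(z)$; for $i<j$, $e^D_{ij}(z)=-\sum_{r_i,\dots,r_{j-1}}\frac{P_{i-1}(p_{i,r_i}-1)\prod_{k=i}^{j-2}P_{k,r_k}(p_{k+1,r_{k+1}}-1)}{(z-p_{i,r_i})\prod_{k=i}^{j-1}P_{k,r_k}(p_{k,r_k})}\prod_{k=i}^{j-1}Z_k(p_{k,r_k})\cdot e^{\sum_{k=i}^{j-1}q_{k,r_k}}$, $f^D_{ji}(z)=\sum_{r_i,\dots,r_{j-1}}\frac{P_j(p_{j-1,r_{j-1}}+1)\prod_{k=i+1}^{j-1}P_{k,r_k}(p_{k-1,r_{k-1}}+1)}{(z-p_{i,r_i}-1)\prod_{k=i}^{j-1}P_{k,r_k}(p_{k,r_k})}\cdot e^{-\sum_{k=i}^{j-1}q_{k,r_k}}$,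 sums over $1\le r_k\le a_k$; $e^D_{ii}=f^D_{ii}=1$. Then $T_D(z)_{\alpha\beta}:=\sum_{i=1}^{\min(\alpha,\beta)}f^D_{\alpha i}(z)g^D_i(z)e^D_{i\beta}(z)$. *)

(* Defs.v *)
From HB Require Import structures.
From mathcomp Require Import all_boot all_order all_algebra.
From mathcomp Require Import fraction complex mpoly.
From mathcomp Require Import Rstruct.
From Stdlib Require Rdefinitions.

Set Implicit Arguments.
Unset Strict Implicit.
Unset Printing Implicit Defensive.

Import Order.TTheory GRing.Theory Num.Theory.
Local Open Scope ring_scope.

Definition CC : fieldType := complex Rdefinitions.R.

(* Lambda^+-valued divisors.  Indices are 1-based as in the paper:         *)
(* epsilon_j for 1 <= j <= n, alpha_i for 1 <= i <= n-1.                   *)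
(* A point  gamma_s varpi_{i_s} [x_s]  is recorded as (i_s, x_s, gamma_s). *)
Record dpoint := DPoint { pt_i : nat; pt_x : CC; pt_g : int }.

Definition valid_point (n : nat) (s : dpoint) : Prop :=
  (pt_i s < n)%N /\ (pt_g s = 1 \/ (pt_i s = 0%N /\ pt_g s = -1)).

(* mu in Lambda^+ : mu j is the coefficient of epsilon_j (1 <= j <= n);    *)
(* alpha_i^vee(mu) = mu_i - mu_{i+1} >= 0 for 1 <= i < n.                  *)
Definition dominant (n : nat) (mu : nat -> int) : Prop :=
  forall i : nat, (1 <= i < n)%N -> mu i.+1 <= mu i.

(* coefficient of epsilon_j in lambda = sum_s gamma_s varpi_{i_s},         *)
(* varpi_i = - sum_{j > i} epsilon_j                                        *)
Definition lam_coef (D : seq dpoint) (j : nat) : int :=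
  - \sum_(s <- D | (pt_i s < j)%N) pt_g s.

Definition Acoef (n : nat) (a : nat -> nat) (i : nat) : nat :=
  if (0 < i < n)%N then a i else 0%N.

(* integrality: lambda + mu = sum_{i=1}^{n-1} a_i alpha_i, compared        *)
(* coefficientwise on epsilon_j, 1 <= j <= n                                *)
Definition integrality (n : nat) (D : seq dpoint) (mu : nat -> int)
    (a : nat -> nat) : Prop :=
  forall j : nat, (1 <= j <= n)%N ->
    lam_coef D j + mu j = (Acoef n a j)%:Z - (Acoef n a j.-1)%:Z.

Section LaxMatrix.
Variables (n : nat) (a : nat -> nat) (D : seq dpoint).

Local Notation A := (Acoef n a).

(* The variables p_{i,r} (1 <= i < n, 0 <= r < a_i; r is 0-based here)    *)
(* are flattened to indices 0 .. Nv-1; index Nv is the spectral variable z.*)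
Definition Nv : nat := \sum_(1 <= i < n) A i.
Definition pidx (i r : nat) : nat := (\sum_(1 <= k < i) A k + r)%N.

Definition Pol := {mpoly CC[Nv.+1]}.
Definition Lf := {fraction Pol}.

Definition var (i r : nat) : 'I_Nv.+1 := inord (pidx i r).

Definition assign := 'I_Nv.+1 -> Lf.
Definition pi0 : assign := fun k => tofrac ('X_k : Pol).

Definition pv (pi : assign) (i r : nat) : Lf := pi (var i r).
Definition zv (pi : assign) : Lf := pi ord_max.

(* Normal forms in A((z^{-1})):  a finite sum  sum_t c_t(p,z) e^{kappa_t.q} *)
(* where kappa_t in Z^{vars} and the coefficient c_t (written to the LEFT  *)
(* of e^{kappa.q}) is a rational expression in p and z, given as a        *)
(* function of the assignment of the p's (so that it can be shifted).      *)
(* Relation [e^{q_{i,r}}, p_{i,r}] = - e^{q_{i,r}} gives                   *)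
(*    e^{kappa.q} c(p) = c(p - kappa) e^{kappa.q}.                          *)
Definition shiftv := {ffun 'I_Nv.+1 -> int}.
Definition term := ((assign -> Lf) * shiftv)%type.

Definition shift (pi : assign) (kappa : shiftv) : assign :=
  fun k => pi k - (kappa k)%:~R.

Definition mulT (s1 s2 : seq term) : seq term :=
  [seq ((fun pi => t1.1 pi * t2.1 (shift pi t1.2)), t1.2 + t2.2)
  | t1 <- s1, t2 <- s2].

Definition scalT (c : assign -> Lf) : seq term := [:: (c, 0)].

Definition unitv (i r : nat) : shiftv := [ffun k => ((k == var i r) : nat)%:Z].

Definition Zk (k : nat) (w : Lf) : Lf :=
  \prod_(s <- D | pt_i s == k) (w - tofrac ((pt_x s)%:MP : Pol)) ^ pt_g s.

Definition Pj (pi : assign) (j : nat) (w : Lf) : Lf :=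
  \prod_(r < A j) (w - pv pi j r).
Definition Pjr (pi : assign) (j r : nat) (w : Lf) : Lf :=
  \prod_(s < A j | (s : nat) != r) (w - pv pi j s).

Fixpoint rtup (i len : nat) : seq (seq nat) :=
  match len with
  | 0 => [:: [::]]
  | len'.+1 => flatten [seq [seq r :: t | t <- rtup i.+1 len'] | r <- iota 0 (A i)]
  end.

Definition gT (i : nat) : seq term :=
  scalT (fun pi => Pj pi i (zv pi) / Pj pi i.-1 (zv pi - 1)
                   * \prod_(0 <= k < i) Zk k (zv pi)).

Definition eT (i j : nat) : seq term :=
  if (i < j)%N then
  [seq (let rr k := nth 0%N t (k - i) in
        ((fun pi =>
           - (Pj pi i.-1 (pv pi i (rr i) - 1)
              * \prod_(i <= k < j.-1) Pjr pi k (rr k) (pv pi k.+1 (rr k.+1) - 1))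
           / ((zv pi - pv pi i (rr i))
              * \prod_(i <= k < j) Pjr pi k (rr k) (pv pi k (rr k)))
           * \prod_(i <= k < j) Zk k (pv pi k (rr k))),
         \sum_(i <= k < j) unitv k (rr k)))
  | t <- rtup i (j - i)]
  else scalT (fun _ => 1).

Definition fT (j i : nat) : seq term :=
  if (i < j)%N then
  [seq (let rr k := nth 0%N t (k - i) in
        ((fun pi =>
           (Pj pi j (pv pi j.-1 (rr j.-1) + 1)
            * \prod_(i.+1 <= k < j) Pjr pi k (rr k) (pv pi k.-1 (rr k.-1) + 1))
           / ((zv pi - pv pi i (rr i) - 1)
              * \prod_(i <= k < j) Pjr pi k (rr k) (pv pi k (rr k)))),
         - \sum_(i <= k < j) unitv k (rr k)))
  | t <- rtup i (j - i)]
  else scalT (fun _ => 1).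

Definition TD (al be : nat) : seq term :=
  flatten [seq mulT (mulT (fT al i) (gT i)) (eT i be)
          | i <- iota 1 (minn al be)].

Definition TDnorm (al be : nat) : seq term :=
  mulT (scalT (fun pi => (Zk 0 (zv pi))^-1)) (TD al be).

Definition coefT (s : seq term) (kappa : shiftv) : Lf :=
  \sum_(t <- s | t.2 == kappa) t.1 pi0.

Definition good_factor (f : nat * nat * nat * int) : bool :=
  let: (i, r, s, m) := f in [&& (0 < i < n)%N, (r < A i)%N, (s < A i)%N & r != s].
Definition factor_val (f : nat * nat * nat * int) : Lf :=
  let: (i, r, s, m) := f in pv pi0 i r - pv pi0 i s + m%:~R.

Definition in_loc_poly (x : Lf) : Prop :=
  exists (Q : Pol) (fs : seq (nat * nat * nat * int)),
    all good_factor fs /\ x * \prod_(f <- fs) factor_val f = tofrac Q.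

Definition in_Az (s : seq term) : Prop :=
  forall kappa : shiftv, in_loc_poly (coefT s kappa).

End LaxMatrix.

(* Main.v *)
Require Import Defs.
From HB Require Import structures.
From mathcomp Require Import all_boot all_order all_algebra.
From mathcomp Require Import fraction complex mpoly.
From mathcomp Require Import boolp ring zify.

(* Moving all exponentials to the right, an entry of Z_0^{-1} T_D becomes a sum
   over i and over pairs of tuples (r_i, ..., r_{al-1}), (r'_i, ..., r'_{be-1})
   of rational functions of z whose only poles are simple ones at the points
   w_{j,s} = p_{j,s} + 1, over the ring of p-polynomials localized at the
   p_{i,r} - p_{i,s} + m.  The summand of level i has a pole at w_{j,s} only if
   i = j + 1 (from P_j(z - 1)), or i = j and r_j = r'_j = s, when f_{al,j} and
   e_{j,be} contribute the same linear factor and P_j cancels only one of them.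
   In the latter case q_{j,s} drops out of the exponent, and the residue is
   opposite to that of the level j + 1 summand obtained by deleting r_j and r'_j.
   Over the common denominator prod (z - w_{j,s}), the numerator is therefore a
   polynomial in z vanishing at all the w_{j,s}, and dividing it by this monic
   product keeps its coefficients in the localized ring. *)

Set Implicit Arguments.
Unset Strict Implicit.
Unset Printing Implicit Defensive.

Import GRing.Theory.
Local Open Scope ring_scope.

(** * Division by monic linear factors over a subring *)

Lemma polyOver_XsubC_quot (F : fieldType) (S : subringClosed F) (c : F)
    (p : {poly F}) :
  c \in S -> p * ('X - c%:P) \is a polyOver S -> p \is a polyOver S.
Proof.
move=> cS /polyOverP pS; apply/polyOverP => i.
(* Descending induction on [i]: the coefficients of a quotient by X - c are determined from the top
   one down. *)
have [k] := ubnP (size p - i)%N; elim: k i => // k IH i lek.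
have [lei|lti] := leqP (size p) i; first by rewrite nth_default ?rpred0.
have -> : p`_i = (p * ('X - c%:P))`_i.+1 + p`_i.+1 * c.
  by rewrite mulrBr coefB coefMX coefMC /= subrK.
by rewrite rpredD ?pS // rpredM // IH //; lia.
Qed.

Lemma polyOver_prod_XsubC_quot (F : fieldType) (S : subringClosed F)
    (ws : seq F) (p : {poly F}) :
  {subset ws <= S} -> p * \prod_(w <- ws) ('X - w%:P) \is a polyOver S ->
  p \is a polyOver S.
Proof.
elim: ws p => [|w ws IH] p wsS; first by rewrite big_nil mulr1.
rewrite big_cons mulrA => /IH pS.
apply: (@polyOver_XsubC_quot _ _ w); first by rewrite wsS ?mem_head.
by apply: pS => x xws; rewrite wsS // inE xws orbT.
Qed.

Lemma horner_div_prod_in (F : fieldType) (S : subringClosed F) (ws : seq F)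
    (p : {poly F}) (z : F) :
  {subset ws <= S} -> uniq ws -> z \in S -> z \notin ws ->
  p \is a polyOver S -> all (root p) ws ->
  p.[z] / \prod_(w <- ws) (z - w) \in S.
Proof.
move=> wsS uws zS zws pS rp.
have [q Eq] := uniq_roots_prod_XsubC rp (etrans (uniq_rootsE ws) uws).
have qS : q \is a polyOver S by apply: polyOver_prod_XsubC_quot wsS _; rewrite -Eq.
rewrite Eq hornerM horner_prod.
under eq_bigr do rewrite hornerXsubC.
rewrite mulfK ?rpred_horner //.
rewrite prodf_seq_neq0; apply/allP => w wws /=.
by rewrite subr_eq0; apply: contraNneq zws => ->.
Qed.

Lemma horner_prod_eq0 (F : fieldType) (I : finType) (P : pred I) (G : I -> {poly F})
    (i : I) (w : F) : P i -> root (G i) w -> (\prod_(j | P j) G j).[w] = 0.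
Proof. by move=> Pi /rootP Gw; rewrite horner_prod (bigD1 i) //= Gw mul0r. Qed.

(** * Index tuples, independence of the variables, and the localized coefficient ring *)

Lemma nth_rtup n a i len t k : t \in rtup n a i len -> (i <= k < i + len)%N ->
  (nth 0%N t (k - i) < Acoef n a k)%N.
Proof.
elim: len i t => [|len IH] i t /=; first by lia.
case/flatten_mapP => r; rewrite mem_iota /= add0n => ltr /mapP [T /IH HT ->].
case: (ltngtP i k) => // [ltik|<-] kb; last by rewrite subnn.
have -> : (k - i = (k - i.+1).+1)%N by lia.
by apply: HT; lia.
Qed.

Section Variables.
Variables (n : nat) (a : nat -> nat).
Local Notation A := (Acoef n a).
Local Notation L := (Lf n a).
Local Notation pi0 := (@pi0 n a).
Local Notation p := (pv pi0).
Local Notation z := (zv pi0).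

Lemma Acoef_supp k r : (r < A k)%N -> (0 < k < n)%N.
Proof. by rewrite /Acoef; case: ifP. Qed.

Lemma pidx_lt i r : (r < A i)%N -> (pidx n a i r < Nv n a)%N.
Proof.
move=> rA; have /andP[i0 iN] := Acoef_supp rA.
rewrite /pidx /Nv (@big_cat_nat _ _ _ i 1 n) //= ?(ltnW iN) // ltn_add2l.
by rewrite big_ltn // ltn_addr.
Qed.

Lemma pidx_lt_block i r j s :
  (r < A i)%N -> (0 < i < j)%N -> (pidx n a i r < pidx n a j s)%N.
Proof.
move=> rA /andP[i0 ij]; rewrite /pidx (@big_cat_nat _ _ _ i 1 j) //= ?(ltnW ij) //.
by rewrite -addnA ltn_add2l big_ltn // -addnA ltn_addr.
Qed.

(** The levels occupy consecutive disjoint blocks of indices, all below [Nv], where [inord] is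
    faithful. *)
Lemma var_eq i r j s : (r < A i)%N -> (s < A j)%N ->
  (var n a i r == var n a j s) = (i == j) && (r == s).
Proof.
move=> rA sA; rewrite -val_eqE /= !inordK ?(ltnW (pidx_lt _)) //; last 2 first.
- by rewrite ltnS ltnW // pidx_lt.
- by rewrite ltnS ltnW // pidx_lt.
have /andP[i0 _] := Acoef_supp rA; have /andP[j0 _] := Acoef_supp sA.
case: (ltngtP i j) => [ij|ji|->] /=.
- by rewrite ltn_eqF // pidx_lt_block // i0.
- by rewrite gtn_eqF // pidx_lt_block // j0.
- by rewrite /pidx eqn_add2l.
Qed.

Lemma var_neq_max i r : (r < A i)%N -> var n a i r != ord_max.
Proof.
move=> rA; rewrite -val_eqE /= inordK ?ltn_eqF ?pidx_lt //.
by rewrite ltnS ltnW // pidx_lt.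
Qed.

(** The coefficient of X_k is 1, whatever the integer shift. *)
Lemma pi0_shift_neq0 (k l : 'I_(Nv n a).+1) (m : int) :
  k != l -> pi0 k - pi0 l + m%:~R != 0.
Proof.
move=> kl; rewrite /Defs.pi0 -tofracB.
have -> : m%:~R = tofrac (m%:~R : Pol n a) by rewrite rmorph_int.
rewrite -tofracD tofrac_eq0; apply/eqP => /(congr1 (mcoeff U_(k)%MM)).
rewrite mcoeffD mcoeffB !mcoeffXU eqxx eq_sym (negPf kl) mcoeff0 subr0.
have -> : (m%:~R : Pol n a) = (m%:~R)%:MP by rewrite rmorph_int.
by rewrite mcoeffC mnm1_eq0 mulr0 addr0 => /eqP; rewrite oner_eq0.
Qed.

Lemma zsubp_neq0 i r (m : int) : (r < A i)%N -> z - p i r + m%:~R != 0.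
Proof. by move=> rA; rewrite pi0_shift_neq0 // eq_sym var_neq_max. Qed.

Lemma psubp_neq0 i r j s (m : int) : (r < A i)%N -> (s < A j)%N ->
  (i != j) || (r != s) -> p i r - p j s + m%:~R != 0.
Proof. by move=> rA sA ne; rewrite pi0_shift_neq0 // var_eq // negb_and. Qed.

Lemma good_factor_neq0 f : good_factor n a f -> factor_val n a f != 0 :> L.
Proof.
case: f => [[[i r] s] m] /= /and4P[_ rA sA rs].
by rewrite /factor_val psubp_neq0 // rs orbT.
Qed.

(** The last variable of [Pol] is z and no inverted factor involves it, so this is the localized
    ring of p-polynomials with z adjoined. *)
Definition loc_poly : {pred L} := fun x => `[< in_loc_poly x >].

Lemma loc_poly_tofrac (Q : Pol n a) : tofrac Q \in loc_poly.
Proof. by apply/asboolP; exists Q, [::]; rewrite big_nil mulr1. Qed.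

Fact loc_poly_subring : subring_closed loc_poly.
Proof.
split.
- by rewrite -tofrac1; apply: loc_poly_tofrac.
- move=> x y /asboolP[Qx [fx [gx Ex]]] /asboolP[Qy [fy [gy Ey]]].
  (* Denominators are themselves polynomials, so a difference has numerator Qx Py - Qy Px over the
     concatenated factors. *)
  have prodP fs : exists Q : Pol n a, \prod_(f <- fs) factor_val n a f = tofrac Q :> L.
    exists (\prod_(f <- fs) (let: (i, r, s, m) := f in
       'X_(var n a i r) - 'X_(var n a i s) + m%:~R)).
    rewrite rmorph_prod; apply: eq_bigr => -[[[i r] s] m] _.
    by rewrite /= tofracD tofracB rmorph_int.
  have [[Px EPx] [Py EPy]] := (prodP fx, prodP fy).
  apply/asboolP; exists (Qx * Py - Qy * Px), (fx ++ fy); split.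
    by rewrite all_cat gx gy.
  by rewrite big_cat /= tofracB !tofracM -Ex -Ey -EPx -EPy; ring.
- move=> x y /asboolP[Qx [fx [gx Ex]]] /asboolP[Qy [fy [gy Ey]]].
  apply/asboolP; exists (Qx * Qy), (fx ++ fy); split; first by rewrite all_cat gx gy.
  by rewrite big_cat /= tofracM -Ex -Ey mulrACA.
Qed.

HB.instance Definition _ := GRing.isSubringClosed.Build L loc_poly loc_poly_subring.

Lemma loc_poly_pi0 k : pi0 k \in loc_poly. Proof. exact: loc_poly_tofrac. Qed.

Lemma loc_poly_inv i r s (m : int) : (r < A i)%N -> (s < A i)%N -> r != s ->
  (p i r - p i s + m%:~R)^-1 \in loc_poly.
Proof.
move=> rA sA rs; apply/asboolP; exists 1, [:: (i, r, s, m)].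
have g : good_factor n a (i, r, s, m) by rewrite /= (Acoef_supp rA) rA sA rs.
by split; [rewrite all_seq1 | rewrite big_seq1 mulVf ?tofrac1 // (good_factor_neq0 g)].
Qed.

End Variables.

(** * Field identities with whole products abstracted to letters *)

Lemma term_identity (F : fieldType) (Z0 W1 f P fn B e Wi en Q Z O : F) :
  Z0 != 0 -> W1 != 0 -> f * P = fn * B -> e * B * Wi = en * Q ->
  Z0^-1 * (f * (P / W1 * (Z0 * Z)) * e) * (Wi * W1 * O) = fn * en * (Q * O * Z).
Proof.
move=> Z00 W10 EF EE.
transitivity (f * P * e * Wi * O * Z); first by field; rewrite Z00 W10.
transitivity (fn * (e * B * Wi) * O * Z); first by rewrite EF; ring.
by rewrite EE; ring.
Qed.

Lemma freg_identity (F : fieldType) (P Y M u V : F) :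
  u != 0 -> P * (Y * M) / (u * V) * u = P * M / V * Y.
Proof. by move=> u0; rewrite invfM; move: (V^-1) => V'; field. Qed.

Lemma ereg_identity (F : fieldType) (P y M u V Z Zs w q : F) : u != 0 ->
  - (P * (y * M)) / (u * V) * (Z * Zs) * u * (w - q) =
  - (- ((q - 1 - w + 1) * y * M) / V * Zs * P * Z).
Proof. by move=> u0; rewrite invfM; move: (V^-1) => V'; field. Qed.

(** Here [d] is the value of the linear denominator of the level [j.+1] factor e ([egap] below);
    multiplying by it turns [Q] into the full product [B * W]. *)
Lemma cancel_identity (F : fieldType) (fj ej f1 e1 u v d B W Q P Zj Z O : F) :
  d != 0 -> fj * u = f1 * B -> ej * v * d = - (e1 * P * Zj) -> Q * d = B * W ->
  fj * ej * (v * u * (W * O) * Z) + f1 * e1 * (Q * (P * O) * (Z * Zj)) = 0.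
Proof.
move=> d0 Ef Ee EQ; apply: (mulIf d0); rewrite mul0r mulrDl.
transitivity ((fj * u) * (ej * v * d) * (W * O) * Z + f1 * e1 * ((Q * d) * (P * O) * (Z * Zj))).
  by ring.
by rewrite Ef Ee EQ; ring.
Qed.

(** * Coefficients of the exponentials in the entry (al, be) *)

Section Residues.
Variables (n : nat) (a : nat -> nat) (D : seq dpoint) (al be : nat).
Local Notation A := (Acoef n a).
Local Notation L := (Lf n a).
Local Notation pi0 := (@pi0 n a).
Local Notation p := (pv pi0).
Local Notation z := (zv pi0).

(** Indexing by the absolute level makes tuples that start at different levels comparable: deleting
    the head does not change the function above [i]. *)
Definition tupf (i : nat) (t : seq nat) (k : nat) : nat := nth 0%N t (k - i).

Definition fshift (i : nat) (rho : nat -> nat) : shiftv n a :=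
  - \sum_(i <= k < al) unitv n a k (rho k).

Definition kappa (i : nat) (rho rho' : nat -> nat) : shiftv n a :=
  fshift i rho + \sum_(i <= k < be) unitv n a k (rho' k).

(* Moving the exponential of f_{al,i} to the right of a function of the p's
   replaces p_{k,r_k} by p_{k,r_k} + 1 in that function; see [spiE]. *)
Definition spi (i : nat) (rho : nat -> nat) : assign n a := shift pi0 (fshift i rho).

(* [freg] and [ereg] are the coefficients of f_{al,i} and e_{i,be} stripped of
   the factor of their denominator that contains z. *)
Definition freg (pi : assign n a) (i : nat) (rho : nat -> nat) : L :=
  if (i < al)%N then
    Pj pi al (pv pi al.-1 (rho al.-1) + 1)
    * \prod_(i.+1 <= k < al) Pjr pi k (rho k) (pv pi k.-1 (rho k.-1) + 1)
    / \prod_(i <= k < al) Pjr pi k (rho k) (pv pi k (rho k))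
  else 1.

Definition ereg (pi : assign n a) (i : nat) (rho : nat -> nat) : L :=
  if (i < be)%N then
    - (Pj pi i.-1 (pv pi i (rho i) - 1)
       * \prod_(i <= k < be.-1) Pjr pi k (rho k) (pv pi k.+1 (rho k.+1) - 1))
    / \prod_(i <= k < be) Pjr pi k (rho k) (pv pi k (rho k))
    * \prod_(i <= k < be) Zk D k (pv pi k (rho k))
  else 1.

Definition fcoef (pi : assign n a) (i : nat) (rho : nat -> nat) : L :=
  if (i < al)%N then freg pi i rho / (zv pi - pv pi i (rho i) - 1) else 1.

Definition ecoef (pi : assign n a) (i : nat) (rho : nat -> nat) : L :=
  if (i < be)%N then ereg pi i rho / (zv pi - pv pi i (rho i)) else 1.

Definition gcoef (pi : assign n a) (i : nat) : L :=
  Pj pi i (zv pi) / Pj pi i.-1 (zv pi - 1) * \prod_(0 <= k < i) Zk D k (zv pi).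

(** Since g carries no exponential, g and e are both read at the assignment shifted by the
    exponential of f alone. *)
Definition tcoef (i : nat) (rho rho' : nat -> nat) : L :=
  (Zk D 0 z)^-1 * (fcoef pi0 i rho * gcoef (spi i rho) i * ecoef (spi i rho) i rho').

Lemma fT_fcoef i :
  fT n a al i = [seq ((fun pi => fcoef pi i (tupf i t)), fshift i (tupf i t))
                | t <- rtup n a i (al - i)].
Proof.
rewrite /fT; case: ifP => ltia.
  apply: eq_map => t; apply: (f_equal2 pair) => //.
  apply/funext => pi; rewrite /fcoef /freg ltia /tupf.
  by rewrite invfM mulrA mulrAC.
have alei : (al <= i)%N by rewrite leqNgt ltia.
by rewrite (eqP alei) /= /scalT /fcoef /fshift ltia big_geq ?oppr0.
Qed.

Lemma eT_ecoef i :
  eT n a D i be = [seq ((fun pi => ecoef pi i (tupf i t)),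
                   \sum_(i <= k < be) unitv n a k (tupf i t k))
                | t <- rtup n a i (be - i)].
Proof.
rewrite /eT; case: ifP => ltib.
  apply: eq_map => t; apply: (f_equal2 pair) => //.
  apply/funext => pi; rewrite /ecoef /ereg ltib /tupf.
  by rewrite invfM [RHS]mulrAC; congr (_ * _); rewrite mulrA mulrAC.
have belei : (be <= i)%N by rewrite leqNgt ltib.
by rewrite (eqP belei) /= /scalT /ecoef ltib big_geq.
Qed.

Lemma shift0 (pi : assign n a) : shift pi 0 = pi.
Proof. by apply/funext => k; rewrite /shift ffunE subr0. Qed.

Lemma coefT_TDnorm ka : coefT (TDnorm n a D al be) ka =
  \sum_(i <- iota 1 (minn al be)) \sum_(t <- rtup n a i (al - i))
    \sum_(t' <- rtup n a i (be - i))
     (if kappa i (tupf i t) (tupf i t') == ka then tcoef i (tupf i t) (tupf i t') else 0).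
Proof.
rewrite /coefT big_mkcond /TDnorm /mulT big_allpairs_dep big_seq1 /TD.
rewrite big_flatten big_map; apply: eq_bigr => i _.
rewrite fT_fcoef eT_ecoef /gT /scalT /mulT !big_allpairs_dep big_map.
apply: eq_bigr => t _; rewrite big_seq1 big_map; apply: eq_bigr => t' _ /=.
by rewrite add0r !addr0 shift0.
Qed.

Definition admissible (i m : nat) (rho : nat -> nat) : Prop :=
  forall k, (i <= k < m)%N -> (rho k < A k)%N.

Lemma spiE i rho k r : admissible i al rho -> (r < A k)%N ->
  pv (spi i rho) k r = p k r + ((i <= k < al)%N && (r == rho k))%:R.
Proof.
move=> ok rA; rewrite /pv /spi /shift /fshift ffunE; congr (_ + _).
rewrite rmorphN opprK sum_ffunE big_nat.
under eq_bigr => l lb.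
  rewrite ffunE var_eq ?ok // [k == l]eq_sym.
  have -> : ((l == k) && (r == rho l))%:Z = if l == k then ((r == rho k) : nat)%:Z else 0.
    by case: eqP => [->|].
  over.
by rewrite -big_nat -big_mkcond big_nat1_eq; case: ifP.
Qed.

Lemma zv_spi i rho : admissible i al rho -> zv (spi i rho) = z.
Proof.
move=> ok; rewrite /zv /spi /shift /fshift ffunE sum_ffunE big_nat big1 ?subr0 // => l lb.
by rewrite ffunE eq_sym (negPf (var_neq_max _)) // ok.
Qed.

Lemma eq_Pjr (pi pi' : assign n a) k s x :
  (forall r, (r < A k)%N -> r != s -> pv pi k r = pv pi' k r) ->
  Pjr pi k s x = Pjr pi' k s x.
Proof. by move=> E; apply: eq_bigr => r rs; rewrite E. Qed.

Lemma eq_Pj (pi pi' : assign n a) k x :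
  (forall r, (r < A k)%N -> pv pi k r = pv pi' k r) -> Pj pi k x = Pj pi' k x.
Proof. by move=> E; apply: eq_bigr => r _; rewrite E. Qed.

Lemma Pj_split (pi : assign n a) k s x : (s < A k)%N ->
  Pj pi k x = (x - pv pi k s) * Pjr pi k s x.
Proof. by move=> sA; rewrite /Pj (bigD1 (Ordinal sA)). Qed.

(** * Poles, and numerators over the common denominator *)

Definition wpole (k r : nat) : L := p k r + 1.

Definition Zpol (k : nat) : {poly L} :=
  \prod_(s <- D | pt_i s == k) ('X - (tofrac ((pt_x s)%:MP : Pol n a))%:P).

(** This is P_i(z) at the shifted variables divided by the linear denominator of f: the shift turns
    the root p_{i,rho i} into the pole of f, which cancels. *)
Definition Bpol (i : nat) (rho : nat -> nat) : {poly L} :=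
  \prod_(s < A i | ~~ ((i < al)%N && (s == rho i :> nat))) ('X - (p i s)%:P).

Definition Wpol (k : nat) : {poly L} := \prod_(r < A k) ('X - (wpole k r)%:P).

(** This is [Bpol i rho * Wpol i] divided by the linear denominator of e at the shifted variables.
    If both tuples agree at [i < al], that denominator vanishes at w_{i,rho i} and must be taken out
    of [Wpol i], which creates the pole; otherwise it is a factor of [Bpol]. *)
Definition Qpol (i : nat) (rho rho' : nat -> nat) : {poly L} :=
  if (i < be)%N then
    if (i < al)%N && (rho i == rho' i) then
      Bpol i rho * \prod_(r < A i | (r : nat) != rho i) ('X - (wpole i r)%:P)
    else
      \prod_(s < A i | ~~ ((i < al)%N && (s == rho i :> nat)) && ((s : nat) != rho' i))
         ('X - (p i s)%:P) * Wpol i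
  else Bpol i rho * Wpol i.

(** The part of the common denominator left over: [Wpol i] is absorbed in [Qpol], and [Wpol i.-1] is
    the denominator of g. *)
Definition Opol (i : nat) : {poly L} :=
  \prod_(k < n.+1 | ((k : nat) != i) && ((k : nat) != i.-1)) Wpol k.

Definition Npol (i : nat) (rho rho' : nat -> nat) : {poly L} :=
  (freg pi0 i rho * ereg (spi i rho) i rho') *:
    (Qpol i rho rho' * Opol i * \prod_(1 <= k < i) Zpol k).

Hypothesis D_valid : List.Forall (valid_point n) D.
Hypotheses (al_n : (1 <= al <= n)%N) (be_n : (1 <= be <= n)%N).

(** A multiplicity -1 occurs only at points with index 0. *)
Lemma Zk_Zpol k (w : L) : (0 < k)%N -> Zk D k w = (Zpol k).[w].
Proof.
move=> k0; rewrite /Zk /Zpol horner_prod; elim: D_valid => [|s D' [_ vs] _ IH].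
  by rewrite !big_nil.
rewrite !big_cons -IH; case: eqP => // sk; rewrite hornerXsubC; congr (_ * _).
by case: vs => [->|[s0 _]]; [rewrite expr1z | rewrite -sk s0 in k0].
Qed.

Lemma Zk0_neq0 : Zk D 0 z != 0.
Proof.
rewrite /Zk prodf_seq_neq0; elim: D => //= s D' ->; rewrite andbT.
apply/implyP => _; apply: expfz_neq0.
rewrite /zv /Defs.pi0 -tofracB tofrac_eq0.
apply/eqP => /(congr1 (mcoeff U_(ord_max)%MM)).
rewrite mcoeffB mcoeffXU eqxx mcoeffC mnm1_eq0 mulr0 mcoeff0 subr0.
by move/eqP; rewrite oner_eq0.
Qed.

Lemma Wpol_Pj k (x : L) : Pj pi0 k (x - 1) = (Wpol k).[x].
Proof.
rewrite horner_prod; apply: eq_bigr => r _.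
by rewrite hornerXsubC /wpole opprD addrA addrAC.
Qed.

Lemma Wpol_z_neq0 k : (Wpol k).[z] != 0.
Proof.
rewrite horner_prod; apply/prodf_neq0 => r _.
rewrite hornerXsubC /wpole opprD addrA.
by have := zsubp_neq0 (-1) (ltn_ord r); rewrite rmorphN.
Qed.

Lemma Qpol_spec i rho rho' : admissible i al rho ->
  (i < be)%N -> (rho' i < A i)%N ->
  Qpol i rho rho' * ('X - (pv (spi i rho) i (rho' i))%:P) = Bpol i rho * Wpol i.
Proof.
move=> ok ltib rA; rewrite /Qpol ltib spiE // leqnn /= [rho' i == _]eq_sym.
case: ifP => [/andP[ltia /eqP E]|nE].
  rewrite E -mulrA /Wpol [in RHS](bigD1 (Ordinal rA)) //=.
  by congr (_ * _); rewrite mulrC.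
rewrite addr0 mulrAC; congr (_ * _).
rewrite [RHS](bigD1 (Ordinal rA)) /=; first by rewrite mulrC.
by rewrite eq_sym nE.
Qed.

Lemma fcoef_Pj i rho : admissible i al rho ->
  fcoef pi0 i rho * Pj (spi i rho) i z = freg pi0 i rho * (Bpol i rho).[z].
Proof.
move=> ok; rewrite horner_prod.
under [in RHS]eq_bigr do rewrite hornerXsubC.
rewrite /fcoef; case: ifP => ltia /=; last first.
  rewrite /freg ltia; congr (_ * _); apply: eq_bigr => r _.
  by rewrite spiE // ltia andbF addr0.
have rA : (rho i < A i)%N by apply: ok; rewrite leqnn.
rewrite (Pj_split _ _ rA) spiE // leqnn ltia eqxx /= opprD addrA -!mulrA; congr (_ * _).
rewrite mulKf; last by have := zsubp_neq0 (-1) rA; rewrite rmorphN.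
by apply: eq_bigr => r ri; rewrite spiE // (negPf ri) andbF addr0.
Qed.

Lemma Wpol_prod i : (0 < i <= n)%N ->
  \prod_(k < n.+1) Wpol k = Wpol i * Wpol i.-1 * Opol i.
Proof.
move=> i_n; have li : (i < n.+1)%N by lia.
have li1 : (i.-1 < n.+1)%N by lia.
rewrite (bigD1 (Ordinal li)) //= (bigD1 (Ordinal li1)) /=; last first.
  by rewrite -val_eqE /=; lia.
by rewrite mulrA.
Qed.

Lemma tcoef_Npol i rho rho' : (0 < i <= n)%N ->
  admissible i al rho -> admissible i be rho' ->
  tcoef i rho rho' = (Npol i rho rho').[z] / (\prod_(k < n.+1) Wpol k).[z].
Proof.
move=> i_n ok ok'; apply: (canRL (mulfK _)).
  by rewrite horner_prod; apply/prodf_neq0 => k _; apply: Wpol_z_neq0.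
(* [big_ltn] isolates the factor Z_0, which the normalization cancels; the remaining Z_k are
   polynomials. *)
rewrite (Wpol_prod i_n) /tcoef /gcoef /Npol hornerZ !hornerM zv_spi // big_ltn; last by lia.
have -> : \prod_(1 <= k < i) Zk D k z = (\prod_(1 <= k < i) Zpol k).[z].
  by rewrite horner_prod; apply: eq_big_nat => k k1; rewrite Zk_Zpol //; lia.
(* The shift moves only variables of level [i] and above. *)
have -> : Pj (spi i rho) i.-1 (z - 1) = (Wpol i.-1).[z].
  rewrite -Wpol_Pj; apply: eq_Pj => r rA; rewrite spiE //.
  have -> : (i <= i.-1)%N = false by lia.
  by rewrite addr0.
have EF := fcoef_Pj ok.
have EE : ecoef (spi i rho) i rho' * (Bpol i rho).[z] * (Wpol i).[z] =
  ereg (spi i rho) i rho' * (Qpol i rho rho').[z].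
  rewrite /ecoef; case: ifP => ltib; last first.
    rewrite /ereg /Qpol ltib.
    rewrite hornerM.
    by rewrite -mulrA.
  have rA : (rho' i < A i)%N by apply: ok'; rewrite leqnn.
  rewrite -[LHS]mulrA -hornerM -(Qpol_spec ok ltib rA) hornerM hornerXsubC zv_spi //.
  rewrite mulrAC mulrA -[LHS]mulrA mulfV ?mulr1 // spiE // opprD addrA.
  have := @zsubp_neq0 n a i (rho' i) (- (((i <= i < al)%N && (rho' i == rho i)) : nat)%:Z) rA.
  by rewrite rmorphN.
exact: term_identity Zk0_neq0 (Wpol_z_neq0 _) EF EE.
Qed.

Lemma Wpol_root k r : (r < A k)%N -> root (Wpol k) (wpole k r).
Proof.
move=> rA; apply/rootP; apply: (@horner_prod_eq0 _ _ _ _ (Ordinal rA)) => //.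
by rewrite root_XsubC.
Qed.

(** For [i != j] the factor [Wpol j] divides [Opol i]; for [i = j] the linear factor at w_{j,s}
    survives in [Qpol] unless both tuples pick [s]. *)
Lemma Npol_regular i rho rho' j s : (s < A j)%N -> i != j.+1 ->
  ~~ [&& i == j, (i < al)%N, (i < be)%N, rho i == s & rho' i == s] ->
  (Npol i rho rho').[wpole j s] = 0.
Proof.
move=> sA nij npole; rewrite /Npol hornerZ !hornerM.
have [eij|neij] := eqVneq i j; last first.
  have /andP[j0 jn] := Acoef_supp sA.
  have jn1 : (j < n.+1)%N by lia.
  have -> : (Opol i).[wpole j s] = 0.
    apply: (@horner_prod_eq0 _ _ _ _ (Ordinal jn1)); last exact: Wpol_root.
    by rewrite /=; lia.
  by rewrite mulr0 mul0r mulr0.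
have -> : (Qpol i rho rho').[wpole j s] = 0.
  have W0 : (Wpol i).[wpole j s] = 0 by rewrite eij; apply/rootP/Wpol_root.
  rewrite /Qpol; case: ifP => [ltib|_]; last by rewrite hornerM [X in _ * X]W0 mulr0.
  case: ifP => [/andP[ltia /eqP E]|_]; last by rewrite hornerM [X in _ * X]W0 mulr0.
  have sAi : (s < A i)%N by rewrite eij.
  rewrite hornerM [X in _ * X](@horner_prod_eq0 _ _ _ _ (Ordinal sAi)) ?mulr0 //=.
    by move: npole; rewrite eij eqxx -eij ltia ltib E eq_sym /= andbb.
  by rewrite eij root_XsubC.
by rewrite !mul0r mulr0.
Qed.

(** * Opposite residues at levels [j] and [j.+1], where [sg], [sg'] are the tails of [rho],
    [rho'] *)

Section Cancellation.
Variables (j : nat) (rho rho' sg sg' : nat -> nat).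
Hypotheses (j_al : (j < al)%N) (j_be : (j < be)%N).
Hypotheses (ok : admissible j al rho) (ok' : admissible j be rho').
Hypotheses (ok1 : admissible j.+1 al sg).
Hypothesis diag : rho' j = rho j.
Hypotheses (rho_sg : forall k, (j < k)%N -> rho k = sg k).
Hypotheses (rho_sg' : forall k, (j < k)%N -> rho' k = sg' k).
Local Notation s := (rho j).
Local Notation w := (wpole j s).
Local Notation pj := (spi j rho).
Local Notation pj1 := (spi j.+1 sg).

Lemma kappa_diag : kappa j rho rho' = kappa j.+1 sg sg'.
Proof.
rewrite /kappa /fshift big_ltn // [in X in _ + X]big_ltn // opprD diag.
rewrite addrACA addNr add0r.
congr (- _ + _); apply: eq_big_nat => k /andP[jk _]; first by rewrite rho_sg.
by rewrite rho_sg'.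
Qed.

Let sA : (s < A j)%N. Proof. by apply: ok; rewrite leqnn. Qed.

Lemma spi_sg k r : (j < k)%N -> (r < A k)%N -> pv pj k r = pv pj1 k r.
Proof. by move=> jk rA; rewrite !spiE // jk (ltnW jk) rho_sg. Qed.

Lemma Pjr_diag_neq0 (m : int) : Pjr pi0 j s (p j s + m%:~R) != 0.
Proof.
apply/prodf_neq0 => r rs.
by rewrite addrAC psubp_neq0 // eq_sym rs orbT.
Qed.

(** Deleting r_j removes the denominator P_{j,s}(p_{j,s}) and the numerator factor evaluated at
    p_{j,s} + 1 = w. That factor is P_{j+1} at w when [al = j.+1], and P_{j+1} without its chosen
    root otherwise; [Bpol] covers both cases. *)
Lemma freg_diag :
  freg pi0 j rho * Pjr pi0 j s (p j s) = freg pi0 j.+1 sg * (Bpol j.+1 sg).[w].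
Proof.
have u0 : Pjr pi0 j s (p j s) != 0 by have := Pjr_diag_neq0 0; rewrite addr0.
have EB : (Bpol j.+1 sg).[w] =
    if (j.+1 < al)%N then Pjr pi0 j.+1 (sg j.+1) w else Pj pi0 j.+1 w.
  rewrite horner_prod; under eq_bigr do rewrite hornerXsubC.
  by case: ifP => /= _.
rewrite EB /freg j_al [in X in _ / X]big_ltn //.
case: ifP => [lt1a|nlt1a]; last first.
  have ea : al = j.+1 by lia.
  by rewrite ea !big_geq //= !mulr1 mul1r mulfVK.
rewrite big_ltn //= (rho_sg (ltnSn j)).
have -> : \prod_(j.+2 <= k < al) Pjr pi0 k (rho k) (p k.-1 (rho k.-1) + 1) =
  \prod_(j.+2 <= k < al) Pjr pi0 k (sg k) (p k.-1 (sg k.-1) + 1).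
  by apply: eq_big_nat => k /andP[jk _]; rewrite !rho_sg //; lia.
have -> : \prod_(j.+1 <= k < al) Pjr pi0 k (rho k) (p k (rho k)) =
  \prod_(j.+1 <= k < al) Pjr pi0 k (sg k) (p k (sg k)).
  by apply: eq_big_nat => k /andP[jk _]; rewrite !rho_sg.
have lj : (j < al.-1)%N by lia.
rewrite (rho_sg lj).
exact: freg_identity u0.
Qed.

(* The value at [w] of the linear denominator z - p_{j+1,r'_{j+1}} (with its p
   shifted) of e_{j+1,be}, which is absent when be = j + 1. *)
Definition egap : L := if (j.+1 < be)%N then w - pv pj1 j.+1 (sg' j.+1) else 1.

Lemma egap_neq0 : egap != 0.
Proof.
rewrite /egap; case: ifP => // lt1b; last by rewrite oner_neq0.
have rA : (sg' j.+1 < A j.+1)%N by rewrite -rho_sg' //; apply: ok'; lia.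
rewrite spiE // /wpole opprD addrA.
set b := _ && _.
have := @psubp_neq0 n a j s j.+1 (sg' j.+1) (1 - (b : nat)%:Z) sA rA.
rewrite rmorphB /= addrA => H.
by rewrite (addrAC (p j s)) H // ltn_eqF.
Qed.

Lemma Qpol_gap : (Qpol j.+1 sg sg').[w] * egap = (Bpol j.+1 sg).[w] * (Wpol j.+1).[w].
Proof.
rewrite /egap; case: ifP => lt1b; last by rewrite /Qpol lt1b mulr1 hornerM.
have rA : (sg' j.+1 < A j.+1)%N by rewrite -rho_sg' //; apply: ok'; lia.
by rewrite -hornerM -(Qpol_spec ok1 lt1b rA) [in RHS]hornerM hornerXsubC.
Qed.

(** The sign has two sources. If [be = j.+1], the level [j.+1] factor is 1 and the sign is the
    leading minus of e. Otherwise both leading signs agree, but level [j.+1] has the full P_j where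
    level [j] has P_{j,s}, and the extra linear factor is [- egap]. *)
Lemma ereg_diag :
  ereg pj j rho' * Pjr pi0 j s w * egap =
  - (ereg pj1 j.+1 sg' * Pj pi0 j.-1 (w - 1) * (Zpol j).[w]).
Proof.
have u0 : Pjr pi0 j s w != 0 := Pjr_diag_neq0 1.
have j0 : (0 < j)%N by have /andP[] := Acoef_supp sA.
have Epv : pv pj j s = w by rewrite spiE // leqnn j_al eqxx.
have EPjr x : Pjr pj j s x = Pjr pi0 j s x.
  by apply: eq_Pjr => r rA rs; rewrite spiE // (negPf rs) andbF addr0.
have EPj0 x : Pj pj j.-1 x = Pj pi0 j.-1 x.
  apply: eq_Pj => r rA; rewrite spiE //.
  have -> : (j <= j.-1)%N = false by lia.
  by rewrite addr0.
(* The assignment [pj1] leaves level [j] unshifted, so its root is p_{j,s} = w - 1, whereas [pj]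
   moves it to w. *)
have EPj x : Pj pj1 j x = (x - w + 1) * Pjr pi0 j s x.
  rewrite (Pj_split _ _ sA); congr (_ * _).
    by rewrite spiE // ltnn addr0 /wpole opprD addrA subrK.
  by apply: eq_Pjr => r rA rs; rewrite spiE // ltnn addr0.
rewrite /egap /ereg j_be diag Epv EPj0 !(big_ltn j_be) /= diag Epv EPjr Zk_Zpol //.
case: ifP => [lt1b|nlt1b]; last first.
  have eb : be = j.+1 by lia.
  rewrite eb !(big_geq (m := j.+1)) // big_geq //= !mulr1 mul1r.
  by rewrite mulrAC mulfVK // mulNr.
have sA' : forall k, (j < k < be)%N -> (sg' k < A k)%N.
  by move=> k jk; rewrite -rho_sg'; [apply: ok'; lia | lia].
have lj : (j < be.-1)%N by lia.
rewrite [in LHS](big_ltn lj) /= diag EPjr EPj.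
rewrite rho_sg' // spi_sg //; last by apply: sA'; rewrite ltnSn lt1b.
have Epvk k : (j < k < be)%N -> pv pj k (rho' k) = pv pj1 k (sg' k).
  by move=> jk; rewrite rho_sg' ?spi_sg ?sA' //; lia.
have EPk k r x : (j < k)%N -> Pjr pj k r x = Pjr pj1 k r x.
  by move=> jk; apply: eq_Pjr => t tA _; rewrite spi_sg.
have -> : \prod_(j.+1 <= k < be.-1) Pjr pj k (rho' k) (pv pj k.+1 (rho' k.+1) - 1) =
  \prod_(j.+1 <= k < be.-1) Pjr pj1 k (sg' k) (pv pj1 k.+1 (sg' k.+1) - 1).
  by apply: eq_big_nat => k jk; rewrite Epvk ?EPk ?rho_sg' //; lia.
have -> : \prod_(j.+1 <= k < be) Pjr pj k (rho' k) (pv pj k (rho' k)) =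
  \prod_(j.+1 <= k < be) Pjr pj1 k (sg' k) (pv pj1 k (sg' k)).
  by apply: eq_big_nat => k jk; rewrite Epvk ?EPk ?rho_sg' //; lia.
have -> : \prod_(j.+1 <= k < be) Zk D k (pv pj k (rho' k)) =
  \prod_(j.+1 <= k < be) Zk D k (pv pj1 k (sg' k)).
  by apply: eq_big_nat => k jk; rewrite Epvk //; lia.
exact: ereg_identity u0.
Qed.

Lemma Npol_cancel : (Npol j rho rho').[w] + (Npol j.+1 sg sg').[w] = 0.
Proof.
have j0 : (0 < j)%N by have /andP[] := Acoef_supp sA.
have /andP[_ jn] := Acoef_supp sA.
rewrite /Npol !hornerZ !hornerM big_nat_recr //= hornerM.
have lj2 : (j.+1 < n.+1)%N by lia.
have lj1 : (j.-1 < n.+1)%N by lia.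
(* The factors common to both levels; [Opol j] has in addition W_{j+1}, and [Opol j.+1] has
   W_{j-1}. *)
pose O := (\prod_(k < n.+1 | [&& (k : nat) != j, (k : nat) != j.-1 & (k : nat) != j.+1]) Wpol k).[w].
have EO : (Opol j).[w] = (Wpol j.+1).[w] * O.
  rewrite /Opol (bigD1 (Ordinal lj2)) /=; last by lia.
  rewrite hornerM; congr (_ * _.[w]); apply: eq_bigl => k.
  by rewrite -val_eqE /= andbA.
have EO1 : (Opol j.+1).[w] = Pj pi0 j.-1 (w - 1) * O.
  rewrite /Opol (bigD1 (Ordinal lj1)) /=; last by lia.
  rewrite hornerM Wpol_Pj; congr (_ * _.[w]); apply: eq_bigl => k.
  by rewrite -val_eqE /=; case: eqP; case: eqP; case: eqP.
(* The two factors match the denominators removed in [ereg_diag] and [freg_diag]: [Bpol] gives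
   P_{j,s}(w), and W_j without its root at w gives P_{j,s}(p_{j,s}). *)
have EQ : (Qpol j rho rho').[w] = Pjr pi0 j s w * Pjr pi0 j s (p j s).
  rewrite /Qpol j_be j_al diag eqxx hornerM; congr (_ * _).
    rewrite horner_prod j_al.
    by apply: eq_bigr => r _; rewrite hornerXsubC.
  rewrite horner_prod.
  by apply: eq_bigr => r _; rewrite hornerXsubC /wpole opprD addrACA subrr addr0.
rewrite EO EO1 EQ.
exact: cancel_identity egap_neq0 freg_diag ereg_diag Qpol_gap.
Qed.

End Cancellation.

(** * Membership of the numerators in the localized ring *)

Local Notation loc := (@loc_poly n a).

Lemma spi_loc i rho k : spi i rho k \in loc.
Proof. by rewrite /spi /shift rpredB ?rpred_int // loc_poly_pi0. Qed.

Lemma Pj_loc (pi : assign n a) k x :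
  (forall v, pi v \in loc) -> x \in loc -> Pj pi k x \in loc.
Proof. by move=> piL xL; apply: rpred_prod => r _; rewrite rpredB // piL. Qed.

Lemma Pjr_loc (pi : assign n a) k s x :
  (forall v, pi v \in loc) -> x \in loc -> Pjr pi k s x \in loc.
Proof. by move=> piL xL; apply: rpred_prod => r _; rewrite rpredB // piL. Qed.

(** Integer shifts change a difference of variables of one level by an integer, and p_{k,s} -
    p_{k,r} + m is inverted for every integer m. *)
Lemma Pjr_inv_loc (pi : assign n a) (m : nat -> int) k s : (s < A k)%N ->
  (forall r, (r < A k)%N -> pv pi k r = p k r + (m r)%:~R) ->
  (Pjr pi k s (pv pi k s))^-1 \in loc.
Proof.
move=> sA Epi; rewrite /Pjr -prodfV; apply: rpred_prod => r rs.
rewrite !Epi // opprD addrACA -mulrzBr.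
by apply: loc_poly_inv => //; rewrite eq_sym.
Qed.

Lemma freg_loc i rho : admissible i al rho -> freg pi0 i rho \in loc.
Proof.
move=> ok; rewrite /freg; case: ifP => _; last exact: rpred1.
have pL v : pi0 v \in loc := loc_poly_pi0 v.
rewrite rpredM // ?rpredM //.
- by apply: Pj_loc => //; rewrite rpredD ?rpred1 // pL.
- by apply: rpred_prod => k _; apply: Pjr_loc => //; rewrite rpredD ?rpred1 // pL.
rewrite -prodfV big_nat; apply: rpred_prod => k kb.
by apply: (@Pjr_inv_loc _ (fun=> 0)) => [|r _]; [apply: ok | rewrite addr0].
Qed.

Lemma Zpol_loc k : Zpol k \is a polyOver loc.
Proof. by apply: rpred_prod => s _; rewrite polyOverXsubC loc_poly_tofrac. Qed.

Lemma ereg_loc i rho rho' : (0 < i)%N -> admissible i al rho -> admissible i be rho' ->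
  ereg (spi i rho) i rho' \in loc.
Proof.
move=> i0 ok ok'; rewrite /ereg; case: ifP => _; last exact: rpred1.
have pL := spi_loc i rho.
have qL k r : pv (spi i rho) k r \in loc by apply: pL.
rewrite rpredM // ?rpredM // ?rpredN ?rpredM //.
- by apply: Pj_loc => //; rewrite rpredB ?rpred1.
- by apply: rpred_prod => k _; apply: Pjr_loc => //; rewrite rpredB ?rpred1.
- rewrite -prodfV big_nat; apply: rpred_prod => k kb.
  apply: (@Pjr_inv_loc _ (fun r => ((i <= k < al)%N && (r == rho k) : nat)%:Z)).
    exact: ok'.
  by move=> r rA; rewrite spiE.
- rewrite big_nat; apply: rpred_prod => k /andP[ik _].
  by rewrite Zk_Zpol ?(leq_trans i0) // rpred_horner ?Zpol_loc.
Qed.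

Lemma wpole_loc k r : wpole k r \in loc.
Proof. by rewrite rpredD ?rpred1 // loc_poly_pi0. Qed.

Lemma Wpol_loc k : Wpol k \is a polyOver loc.
Proof. by apply: rpred_prod => r _; rewrite polyOverXsubC wpole_loc. Qed.

Lemma Npol_loc i rho rho' : (0 < i)%N -> admissible i al rho -> admissible i be rho' ->
  Npol i rho rho' \is a polyOver loc.
Proof.
move=> i0 ok ok'; have pL v : pi0 v \in loc := loc_poly_pi0 v.
have BL : Bpol i rho \is a polyOver loc.
  by apply: rpred_prod => r _; rewrite polyOverXsubC pL.
apply: polyOverZ; first by rewrite rpredM ?freg_loc ?ereg_loc.
apply: rpredM; last by apply: rpred_prod => k _; apply: Zpol_loc.
apply: rpredM; last by apply: rpred_prod => k _; apply: Wpol_loc.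
rewrite /Qpol; case: ifP => _; last exact: rpredM BL (Wpol_loc i).
case: ifP => _.
  apply: (rpredM BL).
  by apply: rpred_prod => r _; rewrite polyOverXsubC wpole_loc.
apply: rpredM; last exact: Wpol_loc.
by apply: rpred_prod => r _; rewrite polyOverXsubC pL.
Qed.

(** * Summation over tuples and levels, and vanishing at every pole *)

Lemma tupf_admissible i m t : (i <= m)%N -> t \in rtup n a i (m - i) ->
  admissible i m (tupf i t).
Proof. by move=> im tr k kb; apply: nth_rtup tr _; rewrite subnKC. Qed.

Lemma sum_rtup_pick (V : nmodType) i len s (F : seq nat -> V) : (s < A i)%N ->
  (forall r T, r != s -> F (r :: T) = 0) ->
  \sum_(t <- rtup n a i len.+1) F t = \sum_(T <- rtup n a i.+1 len) F (s :: T).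
Proof.
move=> sA F0; rewrite /= big_flatten big_map.
transitivity (\sum_(0 <= r < A i | r == s) \sum_(T <- rtup n a i.+1 len) F (r :: T)).
  rewrite [RHS]big_mkcond /index_iota subn0; apply: eq_bigr => r _.
  rewrite big_map; case: eqP => // /eqP rs.
  by rewrite big1 // => T _; rewrite F0.
by rewrite big_nat1_eq sA.
Qed.

Section Total.
Variable ka : shiftv n a.
Local Notation m := (minn al be).

Definition tterm i t t' : {poly L} :=
  if kappa i (tupf i t) (tupf i t') == ka then Npol i (tupf i t) (tupf i t') else 0.

Definition level i : {poly L} :=
  \sum_(t <- rtup n a i (al - i)) \sum_(t' <- rtup n a i (be - i)) tterm i t t'.

Definition Ntot : {poly L} := \sum_(1 <= i < m.+1) level i.

Lemma coefT_Ntot :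
  coefT (TDnorm n a D al be) ka = Ntot.[z] / (\prod_(k < n.+1) Wpol k).[z].
Proof.
rewrite coefT_TDnorm /Ntot horner_sum mulr_suml /index_iota subSS subn0.
apply: eq_big_seq => i; rewrite mem_iota add1n ltnS leq_min => /and3P[i0 ia ib].
rewrite /level horner_sum mulr_suml; apply: eq_big_seq => t tr.
rewrite horner_sum mulr_suml; apply: eq_big_seq => t' tr'.
rewrite /tterm; case: ifP => _; last by rewrite horner0 mul0r.
apply: tcoef_Npol; [lia | exact: tupf_admissible | exact: tupf_admissible].
Qed.

Lemma Ntot_loc : Ntot \is a polyOver loc.
Proof.
rewrite /Ntot big_nat; apply: rpred_sum => i; rewrite ltnS leq_min => /and3P[i0 ia ib].
rewrite /level big_seq; apply: rpred_sum => t tr.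
rewrite big_seq; apply: rpred_sum => t' tr'.
rewrite /tterm; case: ifP => _; last exact: rpred0.
by apply: Npol_loc => //; apply: tupf_admissible.
Qed.

Lemma tterm_regular i t t' j s : (s < A j)%N -> i != j.+1 ->
  ~~ [&& i == j, (i < al)%N, (i < be)%N, tupf i t i == s & tupf i t' i == s] ->
  (tterm i t t').[wpole j s] = 0.
Proof.
move=> sA nij npole; rewrite /tterm; case: ifP => _; last exact: horner0.
exact: Npol_regular.
Qed.

Lemma level_regular i j s : (s < A j)%N -> i != j.+1 ->
  ~~ [&& i == j, (i < al)%N & (i < be)%N] -> (level i).[wpole j s] = 0.
Proof.
move=> sA nij npole; rewrite /level horner_sum big1 // => t _.
rewrite horner_sum big1 // => t' _; apply: tterm_regular => //.
by apply: contra npole => /and5P[-> -> ->].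
Qed.

Lemma level_cancel j s : (s < A j)%N -> (j < m)%N ->
  (level j).[wpole j s] + (level j.+1).[wpole j s] = 0.
Proof.
move=> sA; rewrite leq_min => /andP[ja jb].
have top r T : tupf j (r :: T) j = r by rewrite /tupf subnn.
(* Only pairs of tuples both with head [s] contribute; they are indexed by their tails, just as the
   terms of level [j.+1]. *)
have -> : (level j).[wpole j s] =
    \sum_(T <- rtup n a j.+1 (al - j.+1)) \sum_(T' <- rtup n a j.+1 (be - j.+1))
      (tterm j (s :: T) (s :: T')).[wpole j s].
  rewrite /level horner_sum -!(subnSK ja) (sum_rtup_pick _ sA); last first.
    move=> r T rs; rewrite horner_sum big1 // => t' _; apply: tterm_regular => //; first by lia.
    by rewrite top (negPf rs) !andbF.
  apply: eq_bigr => T _.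
  rewrite horner_sum -!(subnSK jb) (sum_rtup_pick _ sA) // => r T' rs.
  apply: tterm_regular => //; first by lia.
  by rewrite !top (negPf rs) !andbF.
rewrite /level horner_sum -big_split /= big_seq big1 // => T Tr.
rewrite horner_sum -big_split /= big_seq big1 // => T' Tr'.
have cons_tupf r U k : (j < k)%N -> tupf j (r :: U) k = tupf j.+1 U k.
  by move=> jk; rewrite /tupf (_ : k - j = (k - j.+1).+1)%N //; lia.
have cons_adm mm U : (j < mm)%N -> U \in rtup n a j.+1 (mm - j.+1) ->
    admissible j mm (tupf j (s :: U)).
  move=> jm Ur k /andP[]; rewrite leq_eqVlt => /predU1P[<- _|jk km]; first by rewrite top.
  by rewrite cons_tupf //; apply: tupf_admissible Ur _ _ => //; rewrite jk.
(* Paired terms have the same exponent, so both are selected by [ka] or neither is. *)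
rewrite /tterm (@kappa_diag j _ _ (tupf j.+1 T) (tupf j.+1 T')) ?top //; first last.
- by move=> k jk; rewrite cons_tupf.
- by move=> k jk; rewrite cons_tupf.
case: ifP => _; last by rewrite horner0 addr0.
have := @Npol_cancel j (tupf j (s :: T)) (tupf j (s :: T')) (tupf j.+1 T) (tupf j.+1 T').
rewrite !top; apply=> //; try exact: cons_adm; try exact: cons_tupf.
exact: tupf_admissible.
Qed.

Lemma Ntot_root j s : (s < A j)%N -> root Ntot (wpole j s).
Proof.
move=> sA; apply/rootP; rewrite /Ntot horner_sum.
have /andP[j0 _] := Acoef_supp sA.
(* For [j >= m] there is no level [j.+1]; level [j] can occur only as [j = m], where f or e is 1 and
   no double factor arises. *)
have [jm|mj] := ltnP j m; last first.
  rewrite big_nat big1 // => i; rewrite ltnS => /andP[i0 im].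
  move: (im); rewrite leq_min => /andP[ia ib]; apply: level_regular => //.
    by apply/eqP; lia.
  apply/and3P => -[/eqP eij ia' ib'].
  by move: mj; rewrite -eij geq_min leqNgt ia' leqNgt ib'.
rewrite (@big_cat_nat _ _ _ j) //=; last by lia.
rewrite big_nat big1 => [|i ib]; last first.
  by apply: level_regular => //; [apply/eqP; lia | apply/and3P => -[/eqP]; lia].
rewrite add0r big_ltn; last by lia.
rewrite big_ltn; last by lia.
rewrite addrA level_cancel // add0r big_nat big1 // => i ib.
by apply: level_regular => //; [apply/eqP; lia | apply/and3P => -[/eqP]; lia].
Qed.

Lemma in_loc_poly_coefT : in_loc_poly (coefT (TDnorm n a D al be) ka).
Proof.
rewrite coefT_Ntot.
(* Levels 0 and [n] have no variables and add no points to the list. *)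
pose ws := [seq wpole k r | k <- index_iota 0 n.+1, r <- index_iota 0 (A k)].
have wsP w : w \in ws -> exists k r, (r < A k)%N /\ w = wpole k r.
  case/allpairsPdep => k [r [_ rA ->]]; exists k, r; split=> //.
  by move: rA; rewrite mem_index_iota.
have -> : (\prod_(k < n.+1) Wpol k).[z] = \prod_(w <- ws) (z - w).
  rewrite big_allpairs_dep big_mkord horner_prod; apply: eq_bigr => k _.
  rewrite big_mkord horner_prod; apply: eq_bigr => r _.
  by rewrite hornerXsubC.
suff /asboolP : Ntot.[z] / \prod_(w <- ws) (z - w) \in loc by [].
apply: horner_div_prod_in.
- by move=> w /wsP[k [r [_ ->]]]; apply: wpole_loc.
- apply: allpairs_uniq_dep => [|k _|]; rewrite ?iota_uniq //.
  move=> _ _ /allpairsPdep[k [r [_ rA ->]]] /allpairsPdep[l [t [_ tA ->]]] /= /addIr E.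
  move: rA tA; rewrite !mem_index_iota /= => rA tA.
  have [kl|] := boolP ((k != l) || (r != t)); last first.
    by rewrite negb_or !negbK => /andP[/eqP -> /eqP ->].
  by have := psubp_neq0 0 rA tA kl; rewrite E subrr addr0 eqxx.
- exact: loc_poly_pi0.
- apply/negP => /wsP[k [r [rA /eqP]]]; rewrite -subr_eq0 /wpole opprD addrA.
  by have := zsubp_neq0 (-1) rA; rewrite rmorphN => /negPf->.
- exact: Ntot_loc.
- by apply/allP => w /wsP[k [r [rA ->]]]; apply: Ntot_root.
Qed.

End Total.

End Residues.

Theorem theorem2p22 (n : nat) (D : seq dpoint) (mu : nat -> int) (a : nat -> nat) :
  (2 <= n)%N ->
  List.Forall (valid_point n) D ->
  dominant n mu ->
  integrality n D mu a ->
  forall al be : nat, (1 <= al <= n)%N -> (1 <= be <= n)%N ->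
    @in_Az n a (TDnorm n a D al be).
Proof.
move=> _ D_valid _ _ al be al_n be_n ka.
exact: in_loc_poly_coefT.
Qed.
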